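(* Let $\lambda=\{\lambda_n\}_{n\ge1}$ be a positive nonincreasing sequence of real numbers such that $$\sup_{n\ge1} n\lambda_n=\infty .$$ Then there exists $f\in L^2(\mathbb{T}^2)$ such that, for almost every $(x,y)\in\mathbb{T}^2$, the limit of $S_{M,L}(f;x,y)$, as $(M,L)\in\Omega_\lambda$ and $\min\{M,L\}\to\infty$, does not exist.
   Context: $\mathbb{T}=\mathbb{R}/\mathbb{Z}\simeq[0,1)$ is the one-dimensional torus with normalized Lebesgue measure, and $\mathbb{T}^2$ carries the product measure. Functions are complex-valued. Write $\mathrm{e}(t)=\exp(2\pi i t)$. For $f\in L^1(\mathbb{T}^2)$ the Fourier coefficients are $$\widehat f(m,n)=\int_{\mathbb{T}^2} f(x,y)\,\mathrm{e}(-mx-ny)\,dx\,dy,\qquad (m,n)\in\mathbb{Z}^2,$$ and the symmetric rectangular partial sums are $$S_{M,L}(f;x,y)=\sum_{m=-M}^{M}\sum_{n=-L}^{L}\widehat f(m,n)\,\mathrm{e}(mx+ny),\qquad M,L\in\mathbb{N}_0.$$ For a positive sequence $\lambda=\{\lambda_n\}_{n\ge1}$, with $\mathbb{N}=\{1,2,\dots\}$, $$\Omega_\lambda=\left\{(M,L)\in\mathbb{N}^2:\ \frac{1}{1+\lambda_M}\le\frac{M}{L}\le 1+\lambda_L\right\}.$$ The limit of $S_{M,L}(f;x,y)$ as $(M,L)\in\Omega_\lambda$, $\min\{M,L\}\to\infty$ exists if there is $s\in\mathbb{C}$ such that for every $\varepsilon>0$ there is $K$ with $|S_{M,L}(f;x,y)-s|<\varepsilon$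 for all $(M,L)\in\Omega_\lambda$ with $\min\{M,L\}\ge K$. *)

(* Defs.v *)
From HB Require Import structures.
From mathcomp Require Import all_boot all_order all_algebra.
From mathcomp Require Import complex.
From mathcomp Require Import all_classical all_reals all_analysis.
Set Implicit Arguments.
Unset Strict Implicit.
Unset Printing Implicit Defensive.
Import Order.TTheory GRing.Theory Num.Theory.
Import numFieldNormedType.Exports.

Local Open Scope classical_set_scope.
Local Open Scope ring_scope.
Local Open Scope complex_scope.

(* [measurableTypeR R] is R with its Borel sigma-algebra, on which
   [lebesgue_measure] is defined. *)
Local Notation plane R := (measurableTypeR R * measurableTypeR R)%type.

(* The torus is represented by the fundamental domain [0, 1[ and its measure
   by the Lebesgue measure on R: only the values on [torus2 R] of a function
   on R * R matter. *)
Definition torus2 (R : realType) : set (plane R) := `[0, 1[ `*` `[0, 1[.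
Arguments torus2 R : clear implicits.

Definition lebesgue2 (R : realType) :
    {measure set (plane R) -> \bar R} :=
  (@lebesgue_measure R \x @lebesgue_measure R)%E.
Arguments lebesgue2 R : clear implicits.

Definition cexp (R : realType) (t : R) : R[i] :=
  cos (2 * pi * t) +i* sin (2 * pi * t).

Definition cintegral (R : realType) (f : R * R -> R[i]) : R[i] :=
  Rintegral (lebesgue2 R) (torus2 R) (fun p => complex.Re (f p)) +i*
  Rintegral (lebesgue2 R) (torus2 R) (fun p => complex.Im (f p)).

Definition cmeasurable (R : realType) (f : R * R -> R[i]) : Prop :=
  measurable_fun (torus2 R) (fun p => complex.Re (f p)) /\
  measurable_fun (torus2 R) (fun p => complex.Im (f p)).

Definition L2_torus2 (R : realType) (f : R * R -> R[i]) : Prop :=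
  cmeasurable f /\
  (\int[lebesgue2 R]_(p in torus2 R) (Normc.normc (f p) ^+ 2)%:E < +oo)%E.

Definition fourier_coef (R : realType) (f : R * R -> R[i]) (m n : int) : R[i] :=
  cintegral (fun p => f p * cexp (- (m%:~R * p.1) - n%:~R * p.2)).

(* The index i < 2M+1 stands for the frequency i - M in [-M, M]. *)
Definition partial_sum (R : realType) (f : R * R -> R[i]) (M L : nat)
    (p : R * R) : R[i] :=
  \sum_(i < M.*2.+1) \sum_(j < L.*2.+1)
    (let m := i%:Z - M%:Z in let n := j%:Z - L%:Z in
     fourier_coef f m n * cexp (m%:~R * p.1 + n%:~R * p.2)).

Definition Omega (R : realType) (lambda : nat -> R) : set (nat * nat) :=
  [set ML | [/\ (1 <= ML.1)%N, (1 <= ML.2)%N,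
     (1 + lambda ML.1)^-1 <= ML.1%:R / ML.2%:R &
     ML.1%:R / ML.2%:R <= 1 + lambda ML.2]].

Definition Omega_limit_exists (R : realType) (lambda : nat -> R)
    (u : nat -> nat -> R[i]) : Prop :=
  exists s : R[i], forall eps : R, 0 < eps -> exists K : nat,
    forall M L : nat, Omega lambda (M, L) -> (K <= minn M L)%N ->
      Normc.normc (u M L - s) < eps.

(* Main.v *)
Require Import Defs.
From mathcomp Require Import all_boot all_order all_algebra.
From mathcomp Require Import complex lra ring zify.
From mathcomp Require Import all_classical all_reals all_analysis.
From mathcomp Require Import measurable_realfun.
Set Implicit Arguments.
Unset Strict Implicit.
Unset Printing Implicit Defensive.
Import Order.TTheory GRing.Theory Num.Theory.
Import numFieldNormedType.Exports.
Import ComplexField.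
Local Open Scope classical_set_scope.
Local Open Scope ring_scope.
Local Open Scope complex_scope.
Local Notation normc := Normc.normc.

(* Write e(t) for [cexp t]. The building block is a bounded trigonometric
   polynomial modelled on Fefferman's e(n x y): with [P] the Dirichlet sum of
   length [n],
     g(x, y) = n^-2 sum_(k < n) P(x - k/n)^2 e(k (y + 1/2)),
   whose coefficient at (m, k) is, up to sign, e(- m k / n) times a triangular
   weight, and |g| <= 1 by Parseval modulo [n]. Let [a] and [b0] be the integers
   just below n (y + 1/2) and n x. Summing g over the frequencies
   [a - h, a[ x [0, b[ first in k gives, up to a unimodular factor,
   n^-1 (G 0 - G b) with
     G b = sum_(1 <= u <= h) w_u e(- u x) q_u^b / (1 - q_u),
     q_u = e((u + d) / n),   0 <= d < 1.
   For b = b0 all phases align and the kernel 1/(1 - q_u) ~ n/u produces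
   n (1 + 1/2 + ... + 1/h), while the mean of G over 0 <= b < n is O(n), so
   the rectangular sums of g oscillate by at least a multiple of log h at
   every (x, y). As n lambda_n is unbounded, [Omega lambda] contains
   arbitrarily far full squares of any prescribed size; translating such
   blocks, with coefficients 2^-j, into these squares gives a uniformly
   convergent series, whose partial sums over [Omega lambda] diverge
   everywhere. *)

(** * Modulus, real part and imaginary part of complex numbers *)

Lemma normc_ge0 (R : rcfType) (z : R[i]) : 0 <= normc z.
Proof. by case: z => a b; exact: sqrtr_ge0. Qed.

Lemma ler_normc_sum (R : rcfType) (I : Type) (r : seq I) (P : pred I)
    (F : I -> R[i]) :
  normc (\sum_(i <- r | P i) F i) <= \sum_(i <- r | P i) normc (F i).
Proof.
elim/big_ind2 : _ => // [|x1 x2 y1 y2 h1 h2]; first by rewrite Normc.normc0.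
exact: le_trans (le_normcD _ _) (lerD h1 h2).
Qed.

Lemma normc_sqrE (R : rcfType) (z : R[i]) :
  normc z ^+ 2 = complex.Re z ^+ 2 + complex.Im z ^+ 2.
Proof. by case: z => a b; rewrite sqr_sqrtr // addr_ge0 // sqr_ge0. Qed.

Lemma ler_normr_Re (R : rcfType) (z : R[i]) : `|complex.Re z| <= normc z.
Proof.
rewrite -(ler_pXn2r (n := 2)) ?nnegrE ?normc_ge0 //.
by rewrite normc_sqrE real_normK ?num_real // lerDl sqr_ge0.
Qed.

Lemma ler_normr_Im (R : rcfType) (z : R[i]) : `|complex.Im z| <= normc z.
Proof.
rewrite -(ler_pXn2r (n := 2)) ?nnegrE ?normc_ge0 //.
by rewrite normc_sqrE real_normK ?num_real // lerDr sqr_ge0.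
Qed.

Lemma ler_normc_ReIm (R : rcfType) (z : R[i]) :
  normc z <= `|complex.Re z| + `|complex.Im z|.
Proof.
rewrite -(ler_pXn2r (n := 2)) ?nnegrE ?normc_ge0 ?addr_ge0 //.
rewrite normc_sqrE sqrrD !real_normK ?num_real //.
by rewrite lerD2r lerDl mulrn_wge0 // mulr_ge0.
Qed.

Lemma normc_real (R : rcfType) (a : R) : normc a%:C = `|a|.
Proof. by rewrite /normc /= expr0n /= addr0 sqrtr_sqr. Qed.

Lemma normc_distC (R : rcfType) (z w : R[i]) : normc (z - w) = normc (w - z).
Proof. by rewrite -normcN opprB. Qed.

(** * Characters, sums over roots of unity, Dirichlet sums and their squares *)

Section cexp.
Context {R : realType}.
Implicit Types s t : R.

Lemma cexpD s t : cexp (s + t) = cexp s * cexp t :> R[i].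
Proof.
rewrite /cexp mulrDr cosD sinD.
by apply/eqP; rewrite eq_complex /= eqxx /= addrC.
Qed.

Lemma cexp0 : cexp 0 = 1 :> R[i].
Proof. by rewrite /cexp mulr0 cos0 sin0. Qed.

Lemma normc_cexp t : normc (cexp t) = 1.
Proof. by rewrite /cexp /normc cos2Dsin2 sqrtr1. Qed.

Lemma cexpN t : cexp (- t) = (cexp t)^*.
Proof. by rewrite /cexp mulrN cosN sinN. Qed.

Lemma cexp1 : cexp 1 = 1 :> R[i].
Proof. by rewrite /cexp mulr1 mulr_natl cos2pi sin2pi. Qed.

Lemma cexpMn (n : nat) t : cexp (n%:R * t) = cexp t ^+ n.
Proof.
elim: n => [|n IH]; first by rewrite mul0r cexp0 expr0.
by rewrite exprS -IH -cexpD; congr cexp; rewrite -natr1; ring.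
Qed.

Lemma cexp_nat (n : nat) : cexp n%:R = 1 :> R[i].
Proof. by rewrite -[n%:R]mulr1 cexpMn cexp1 expr1n. Qed.

(** If e(t) = 1, then cos(2 pi t) = 1 - 2 sin(pi t)^2 forces sin(pi t) = 0, whereas 0 < pi t <
    pi. *)
Lemma cexp_neq1 t : 0 < t < 1 -> cexp t != 1.
Proof.
move=> /andP[t0 t1]; apply/eqP => -[c s].
have p0 := pi_gt0 R.
have := @sin_gt0_pi R (pi * t); rewrite mulr_gt0 //= gtr_pMr // => /(_ t1).
have : cos (2 * pi * t) = 1 - 2 * sin (pi * t) ^+ 2.
  rewrite (_ : 2 * pi * t = pi * t *+ 2); last by rewrite -mulr_natl; ring.
  by rewrite cos_mulr2n cos2sin2; ring.
rewrite c => h; have /eqP : sin (pi * t) ^+ 2 = 0 by lra.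
by rewrite sqrf_eq0 => /eqP ->; rewrite ltxx.
Qed.

(** This is a geometric sum whose ratio q satisfies q^n = 1 and q <> 1. *)
Lemma sum_cexp_root (n d : nat) : (0 < d < n)%N ->
  \sum_(k < n) cexp (k%:R * (d%:R / n%:R)) = 0 :> R[i].
Proof.
move=> /andP[d0 dn]; have n0 : (0 < n)%N by exact: leq_trans dn.
have n0R : n%:R != 0 :> R by rewrite pnatr_eq0 -lt0n.
under eq_bigr do rewrite cexpMn.
have q1 : cexp (d%:R / n%:R : R) - 1 != 0.
  rewrite subr_eq0; apply: cexp_neq1.
  by rewrite divr_gt0 ?ltr0n // ltr_pdivrMr ?ltr0n // mul1r ltr_nat.
apply: (mulfI q1); rewrite mulr0 -subrX1 -cexpMn.
by rewrite mulrC divfK // cexp_nat subrr.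
Qed.

Lemma sum_cexp_rootN (n d : nat) : (0 < d < n)%N ->
  \sum_(k < n) cexp (- (k%:R * (d%:R / n%:R))) = 0 :> R[i].
Proof.
move=> dn; under eq_bigr do rewrite cexpN.
by rewrite -rmorph_sum sum_cexp_root // rmorph0.
Qed.

Definition dirichlet (n : nat) t : R[i] := \sum_(i < n) cexp (i%:R * t).

(** Expand the square and sum over [k] first: off-diagonal pairs (i, j) vanish by orthogonality of
    the n-th roots of unity, and each of the [n] diagonal pairs contributes [n]. *)
Lemma dirichlet_Parseval (n : nat) t :
  \sum_(k < n) normc (dirichlet n (t - k%:R / n%:R)) ^+ 2 = n%:R ^+ 2.
Proof.
apply: complexI; rewrite rmorph_sum /=.
under eq_bigr => k _.
  rewrite (_ : _%:C = \sum_(i < n) \sum_(j < n)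
    cexp (i%:R * t - j%:R * t) *
    cexp (k%:R * (j%:R / n%:R) - k%:R * (i%:R / n%:R))).
    over.
  rewrite normc_sqrE add_Re2_Im2 sqr_normc /dirichlet rmorph_sum big_distrlr /=.
  apply: eq_bigr => i _; apply: eq_bigr => j _.
  rewrite -[X in _ * X = _]cexpN -!cexpD; congr cexp; rewrite !mulrBr; ring.
rewrite exchange_big /=.
under eq_bigr => i _.
  rewrite exchange_big /= (bigD1 i) //=.
  rewrite (eq_bigr (fun=> 1)); last by move=> k _; rewrite !subrr cexp0 mulr1.
  rewrite sumr_const card_ord big1 ?addr0; last first.
    move=> j ji; rewrite -mulr_sumr; apply/eqP; rewrite mulf_eq0; apply/orP; right.
    apply/eqP; have [lt|gt|e] := ltngtP i j;
      last by move/val_inj: e ji => ->; rewrite eqxx.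
    - rewrite -[RHS](@sum_cexp_root n (j - i)); last first.
        by rewrite subn_gt0 lt /=; apply: leq_ltn_trans (ltn_ord j); apply: leq_subr.
      by apply: eq_bigr => k _; congr cexp; rewrite natrB 1?ltnW//; ring.
    - rewrite -[RHS](@sum_cexp_rootN n (i - j)); last first.
        by rewrite subn_gt0 gt /=; apply: leq_ltn_trans (ltn_ord i); apply: leq_subr.
      by apply: eq_bigr => k _; congr cexp; rewrite natrB 1?ltnW//; ring.
  over.
by rewrite sumr_const card_ord rmorphXn /= rmorph_nat expr2 mulr_natr.
Qed.

(** The number of ways to write [m] as i + j with i, j < [n], that is, the coefficients of the
    squared Dirichlet sum. It vanishes at m = 2n - 1, so the range [n.*2] below carries one harmless
    zero term. *)
Definition tri (n m : nat) : nat := \sum_(i < n) ((i <= m) && (m < i + n))%N.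

Lemma dirichlet_sqr (n : nat) t :
  dirichlet n t ^+ 2 = \sum_(m < n.*2) (tri n m)%:R * cexp (m%:R * t).
Proof.
rewrite expr2 /dirichlet big_distrlr /=.
under [RHS]eq_bigr do rewrite /tri natr_sum mulr_suml.
rewrite [RHS]exchange_big /=; apply: eq_bigr => i _.
under eq_bigr do rewrite -cexpD -mulrDl -natrD.
rewrite -(big_mkord xpredT (fun m => (((i <= m) && (m < i + n))%N)%:R * cexp (m%:R * t))).
rewrite (@big_cat_nat _ _ _ i) ?leq0n //=; last by have := ltn_ord i; lia.
rewrite [X in _ = X + _]big1_seq ?add0r; last first.
  by move=> m; rewrite mem_index_iota /= => mi; rewrite [(i <= m)%N]leqNgt mi mul0r.
rewrite (@big_cat_nat _ _ _ (i + n)) //=; [|lia|by have := ltn_ord i; lia].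
rewrite [X in _ = _ + X]big1_seq ?addr0; last first.
  move=> m; rewrite mem_index_iota /= => /andP[im _].
  by rewrite ltnNge im andbF mul0r.
rewrite -{2}[val i]add0n big_addn addKn big_mkord.
apply: eq_bigr => j _; rewrite [(j + i)%N]addnC leq_addr /= ltn_add2l ltn_ord mul1r //.
Qed.

Lemma tri_le (n m : nat) : (tri n m <= n)%N.
Proof.
rewrite -[leqRHS]card_ord -sum1_card; apply: leq_sum => i _; exact: leq_b1.
Qed.

(** The count is m + 1 when m < n and 2n - 1 - m when n <= m < 2n. The condition [1 < n] absorbs the
    -1 of the second case. *)
Lemma tri_ge (n m : nat) : (1 < n)%N -> (n <= 4 * m)%N ->
  (2 * m < 3 * n)%N -> (n <= 4 * tri n m)%N.
Proof.
move=> n1 h1 h2; rewrite /tri.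
rewrite -(big_mkord xpredT (fun i => ((i <= m) && (m < i + n))%N : nat)).
have [mn|nm] := ltnP m n.
  rewrite (@big_cat_nat _ _ _ m.+1) //=.
  rewrite mulnDr; apply: leq_trans (leq_addr _ _).
  rewrite (eq_big_nat _ _ (F2 := fun=> 1%N)); last first.
    by move=> i /andP[_ im]; rewrite -ltnS im /= ltn_addl.
  by rewrite sum_nat_const_nat; lia.
rewrite (@big_cat_nat _ _ _ (m.+1 - n)) //=; last lia.
rewrite mulnDr; apply: leq_trans (leq_addl _ _).
rewrite (eq_big_nat _ _ (F2 := fun=> 1%N)); last first.
  by move=> i /andP[im i_n]; rewrite (_ : (_ <= _)%N) //=; lia.
by rewrite sum_nat_const_nat; lia.
Qed.

End cexp.

(** * Estimates for the kernel 1/(1 - e(t)) *)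

Lemma Im_sum (R : rcfType) (I : Type) (r : seq I) (P : pred I) (F : I -> R[i]) :
  complex.Im (\sum_(i <- r | P i) F i) = \sum_(i <- r | P i) complex.Im (F i).
Proof. by apply: big_morph => // -[a b] [c d]. Qed.

Section kernel.
Context {R : realType}.
Implicit Types s t x : R.

Lemma sin_mean_value t : 0 <= t -> exists2 c, 0 <= c <= t & sin t = cos c * t :> R.
Proof.
move=> t0; have [|c] := @MVT_segment R sin cos 0 t t0.
- by apply: continuous_subspaceT => y; exact: continuous_sin.
by rewrite in_itv /= sin0 !subr0 => ? ?; exists c.
Qed.

Lemma sin_le t : 0 <= t -> sin t <= t.
Proof.
by move=> t0; have [c _ ->] := sin_mean_value t0; rewrite ler_piMl ?cos_le1.
Qed.

Lemma cos_ge t : 0 <= t <= 1 -> 1 / 2 <= cos t.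
Proof.
move=> /andP[t0 t1]; have -> : t = (t / 2) *+ 2 by lra.
rewrite cos_mulr2n cos2sin2.
have s1 : sin (t / 2) <= t / 2 by rewrite sin_le ?divr_ge0.
have s0 : 0 <= sin (t / 2).
  apply: sin_ge0_pi; have := pi_ge2 R; lra.
have s2 : sin (t / 2) ^+ 2 <= 1 / 4 by nra.
lra.
Qed.

Lemma sin_ge t : 0 <= t <= 1 -> t / 2 <= sin t.
Proof.
move=> /andP[t0 t1]; have [c /andP[c0 ct] ->] := sin_mean_value t0.
rewrite mulrC ler_wpM2r // -[2^-1]mul1r; apply: cos_ge; lra.
Qed.

Lemma cexp_small t : 0 <= t <= 1 / 64 ->
  1 / 2 <= complex.Re (cexp t) /\ 0 <= complex.Im (cexp t) <= 1.
Proof.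
move=> /andP[t0 t1]; have p0 := pi_gt0 R; have := @pihalf_lt2 R => p4.
have tp : 0 <= pi * t by rewrite mulr_ge0 // ltW.
have tp1 : pi * t <= 4 * t by rewrite ler_wpM2r //; lra.
rewrite /cexp /= -mulrA; split; first by apply: cos_ge; lra.
by rewrite sin_le1 andbT; apply: sin_ge0_pi; have := pi_ge2 R; lra.
Qed.

(** With a = pi t, the inverse equals 1/2 + (i/2) cot a; the bounds follow from 2t <= a <= 4t and |1
    - e(t)| >= sin(2a) >= a. *)
Lemma inv_onemcexp t : 0 < t <= 1 / 32 ->
  [/\ complex.Re (1 - cexp t)^-1 = 1 / 2,
      1 / (16 * t) <= complex.Im (1 - cexp t)^-1 &
      normc (1 - cexp t)^-1 <= 1 / (2 * t)].
Proof.
move=> /andP[t0 t1]; have p0 := pi_ge2 R; have := @pihalf_lt2 R => p4.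
set a := pi * t.
have a0 : 2 * t <= a by rewrite ler_wpM2r // ltW.
have a1 : a <= 4 * t by rewrite ler_wpM2r //; lra.
have sa0 : 0 < sin a by apply: sin_gt0_pi; lra.
have sa : sin a <= 4 * t by apply: le_trans a1; apply: sin_le; lra.
have ca : 1 / 2 <= cos a by apply: cos_ge; lra.
have e : cexp t = (1 - 2 * sin a ^+ 2) +i* (2 * (cos a * sin a)).
  rewrite /cexp (_ : 2 * pi * t = a *+ 2); last by rewrite -mulr_natl /a; ring.
  by rewrite cos_mulr2n sin_mulr2n -mulr_natl; congr (_ +i* _); rewrite ?cos2sin2; ring.
have c2 := cos2Dsin2 a.
have inv : (1 - cexp t)^-1 = (1 / 2) +i* (cos a / (2 * sin a)).
  apply: mulr1_eq; rewrite e; apply/eqP; rewrite eq_complex /=.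
  rewrite [cos a / _]mulrC; apply/andP; split; apply/eqP.
    transitivity (sin a ^+ 2 + cos a ^+ 2); [by field; lra|by rewrite addrC].
  by field; lra.
split.
- by rewrite inv.
- rewrite inv /=; rewrite ler_pdivrMr ?mulr_gt0 //.
  rewrite mulrAC ler_pdivlMr ?mulr_gt0 // mul1r; nra.
rewrite Normc.normcV div1r lef_pV2 ?posrE; last 2 first.
- rewrite lt_def normc_ge0 andbT; apply/eqP => /Normc.eq0_normc.
  by rewrite e => -[]; nra.
- by lra.
apply: le_trans (ler_normr_Im _); rewrite e /= sub0r normrN.
apply: le_trans (ler_norm _).
rewrite (_ : 2 * (cos a * sin a) = sin (a *+ 2)); last first.
  by rewrite sin_mulr2n mulr_natl.
apply: le_trans (a0) _; apply: le_trans (sin_ge _); lra.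
Qed.

Lemma sum_inv_sqr_le (h : nat) : \sum_(i < h) (i.+1%:R : R) ^- 2 <= 2.
Proof.
(* The telescoping bound 2 - 1/h fails at h = 0, where [h%:R^-1] is 0; the last summand corrects
   that case only. *)
suff : \sum_(i < h) (i.+1%:R : R) ^- 2 <= 2 - h%:R^-1 + (h == 0%N)%:R * -2.
  move=> /le_trans; apply; case: h => [|h] /=; first by rewrite invr0; lra.
  by rewrite mul0r addr0 gerBl invr_ge0.
elim: h => [|h IH]; first by rewrite big_ord0 invr0 /=; lra.
rewrite big_ord_recr /=; apply: le_trans (lerD IH (lexx _)) _.
rewrite mul0r addr0; case: h {IH} => [|h] /=; first by rewrite invr0 expr1n; lra.
rewrite mul0r addr0 -subr_ge0.
have -> : 2 - h.+2%:R^-1 - (2 - h.+1%:R^-1 + h.+2%:R ^- 2) =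
    (h.+1%:R * h.+2%:R ^+ 2)^-1 :> R.
  by rewrite -[h.+2%:R]natr1; field; rewrite nat1r natr1 !pnatr_eq0.
by rewrite invr_ge0 mulr_ge0 ?exprn_ge0.
Qed.

(* Every term has imaginary part at least a multiple of n/u: the phases
   e(- u s) stay close to 1 because u s < h / n. *)
Lemma kernel_sum_lower (n h : nat) (s d : R) (w : nat -> R) :
  (0 < h)%N -> (64 * h <= n)%N -> 0 <= d < 1 -> 0 <= s < n%:R^-1 ->
  (forall i, (i < h)%N -> 1 / 4 <= w i <= 1) ->
  n%:R * ((\sum_(i < h) i.+1%:R^-1) / 256 - 1) <=
  normc (\sum_(i < h) (w i)%:C * cexp (- (i.+1%:R * s)) *
           (1 - cexp ((i.+1%:R + d) / n%:R))^-1).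
Proof.
move=> h0 hn /andP[d0 d1] /andP[s0 s1] hw.
have n0 : 0 < n%:R :> R by rewrite ltr0n; lia.
apply: le_trans (ler_normr_Im _); apply: le_trans (ler_norm _).
rewrite Im_sum mulrBr mulr1 mulr_suml mulr_sumr.
have hn' : h%:R <= n%:R :> R by rewrite ler_nat; lia.
(* Termwise, 256 = 4 * 2 * 32: the weight is at least 1/4, the cosine of the phase at least 1/2, and
   Im z at least n/(32u). The real part 1/2 of z costs at most 1/2 per term, and the [h] unit losses
   amount to at most [n]. *)
apply: (@le_trans _ _ (\sum_(i < h) (n%:R * (i.+1%:R^-1 / 256) - 1))).
  by rewrite big_split /= sumrN sumr_const card_ord lerD2l lerN2.
apply: ler_sum => i _.
have /andP[w1 w2] := hw i (ltn_ord i).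
set u : R := i.+1%:R; set q := cexp _; set c := cexp _.
have u1 : 1 <= u by rewrite ler1n.
have un : 64 * u <= n%:R by rewrite -natrM ler_nat; have := ltn_ord i; lia.
have [] := @inv_onemcexp ((u + d) / n%:R).
  apply/andP; split; first by rewrite divr_gt0 //; lra.
  by rewrite ler_pdivrMr //; lra.
rewrite -/c; set z := (1 - c)^-1 => Re_z Im_z _.
have us : 0 <= u * s <= 1 / 64.
  apply/andP; split; first by rewrite mulr_ge0 //; lra.
  apply: (@le_trans _ _ (u / n%:R)).
    by apply: ler_wpM2l; [lra|exact: ltW].
  by rewrite ler_pdivrMr //; lra.
have [Re_q /andP[Im_q0 Im_q1]] := cexp_small us.
have -> : complex.Im ((w i)%:C * q * z) =
   w i * (complex.Re (cexp (u * s)) * complex.Im z - complex.Im (cexp (u * s)) / 2).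
  rewrite /q cexpN; move: Re_z; case: (cexp _) => a b; case: z {Im_z} => p r /= ->.
  by field.
have z1 : n%:R / (32 * u) <= complex.Im z.
  apply: le_trans Im_z; rewrite (_ : 1 / _ = n%:R / (16 * (u + d))); last first.
    by field; apply/andP; split; lra.
  by rewrite ler_pM2l // lef_pV2 ?posrE //; lra.
have nu : n%:R * (u^-1 / 256) = n%:R / (32 * u) / 8 by field; lra.
rewrite nu; move: z1; set y := n%:R / _ => z1.
have y0 : 0 <= y by rewrite divr_ge0 //; lra.
have A1 : y / 2 <= complex.Re (cexp (u * s)) * complex.Im z.
  by rewrite mulrC; apply: ler_pM => //; lra.
have A2 : y / 2 * (1 / 4) <= w i * (complex.Re (cexp (u * s)) * complex.Im z).
  by rewrite mulrC; apply: ler_pM => //; lra.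
have A3 : w i * (complex.Im (cexp (u * s)) / 2) <= 1 * (1 / 2).
  by apply: ler_pM => //; lra.
rewrite mulrBr; lra.
Qed.

(** Summing over [b] first gives (1 - q^n)/(1 - q), hence a second factor 1/(1 - q). Each term
    becomes at most n^2/(2u^2), and the sum of u^-2 is at most 2. *)
Lemma kernel_sum_mean (n h : nat) (d : R) (z : nat -> R[i]) :
  (0 < h)%N -> (64 * h <= n)%N -> 0 <= d < 1 ->
  (forall i, (i < h)%N -> normc (z i) <= 1) ->
  normc (\sum_(b < n) \sum_(i < h) z i * (1 - cexp ((i.+1%:R + d) / n%:R))^-1 *
           cexp ((i.+1%:R + d) / n%:R) ^+ b) <= n%:R ^+ 2.
Proof.
move=> h0 hn /andP[d0 d1] hz.
have n0 : 0 < n%:R :> R by rewrite ltr0n; lia.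
rewrite exchange_big /=; apply: le_trans (ler_normc_sum _ _ _) _.
apply: (@le_trans _ _ (\sum_(i < h) n%:R ^+ 2 / 2 * i.+1%:R ^- 2)); last first.
  rewrite -mulr_sumr; have := sum_inv_sqr_le h.
  by have : 0 < n%:R ^+ 2 :> R by [rewrite exprn_gt0]; nra.
apply: ler_sum => i _; rewrite -mulr_sumr.
set u : R := i.+1%:R; set t := (u + d) / n%:R.
have u1 : 1 <= u by rewrite ler1n.
have un : 64 * u <= n%:R by rewrite -natrM ler_nat; have := ltn_ord i; lia.
have t0 : 0 < t by rewrite divr_gt0 //; lra.
have t1 : t <= 1 / 32 by rewrite ler_pdivrMr //; lra.
have [|_ _ nc] := @inv_onemcexp t; first by rewrite t0.
set c := (1 - cexp t)^-1 in nc *.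
have -> : \sum_(b < n) cexp t ^+ b = (1 - cexp t ^+ n) * c.
  apply: canRL (mulfK _) _; first by rewrite subr_eq0 eq_sym cexp_neq1 //; lra.
  by rewrite -opprB mulrN mulrC -subrX1 opprB.
rewrite !Normc.normcM.
have n1 : normc (1 - cexp t ^+ n) <= 2.
  apply: le_trans (le_normcD _ _) _.
  by rewrite normcN -cexpMn normc_cexp Normc.normc1; lra.
have z1 := hz i (ltn_ord i).
have c0 := normc_ge0 c; have := normc_ge0 (z i).
have := normc_ge0 (1 - cexp t ^+ n) => ? ?.
apply: (@le_trans _ _ (2 * (normc c) ^+ 2)).
  by rewrite -mulrA [X in _ * X]mulrCA -expr2 mulrA ler_wpM2r ?sqr_ge0 //; nra.
have c1 : normc c <= n%:R / (2 * u).
  apply: le_trans nc _; rewrite (_ : 1 / _ = n%:R / (2 * (u + d))); last first.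
    by rewrite /t; field; apply/andP; split; lra.
  by rewrite ler_pM2l // lef_pV2 ?posrE //; lra.
have : normc c * normc c <= n%:R / (2 * u) * (n%:R / (2 * u)) by apply: ler_pM.
rewrite (_ : _ / _ * _ = n%:R ^+ 2 * u ^- 2 / 4); last by field; lra.
rewrite -(expr2 (normc c)) => c2.
rewrite [leRHS](_ : _ = 2 * (n%:R ^+ 2 * u ^- 2 / 4)) ?ler_pM2l //; field; lra.
Qed.

End kernel.

Section fefferman_block.
Context {R : realType}.

(** Write n G(b0) as the sum over b of G(b0) - G(b) plus the sum over b of G(b). The latter is at
    most n^2, so a large G(b0) forces some large difference. The loss 2 is one from the lower bound
    for G(b0) and one from the mean. *)
Lemma kernel_sum_oscillation (n h b0 : nat) (x d L : R) (w : nat -> R) :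
  (0 < h)%N -> (64 * h <= n)%N -> (b0 < n)%N -> 0 <= d < 1 ->
  0 <= x - b0%:R / n%:R < n%:R^-1 ->
  (forall i, (i < h)%N -> 1 / 4 <= w i <= 1) ->
  let G b := \sum_(i < h) (w i)%:C * cexp (- (i.+1%:R * x)) *
    (1 - cexp ((i.+1%:R + d) / n%:R))^-1 * cexp ((i.+1%:R + d) / n%:R) ^+ b in
  (forall b, (b < n)%N -> normc (G b0 - G b) <= n%:R * L) ->
  (\sum_(i < h) i.+1%:R^-1) / 256 - 2 <= L.
Proof.
move=> h0 hn b0n d01 xb0 hw G hG.
have n0 : 0 < n%:R :> R by rewrite ltr0n; lia.
have lower := kernel_sum_lower h0 hn d01 xb0 hw.
have mean := kernel_sum_mean (z := fun i => (w i)%:C * cexp (- (i.+1%:R * x))) h0 hn d01.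
have {}mean : normc (\sum_(b < n) G b) <= n%:R ^+ 2.
  apply: mean => i ih; have /andP[w1 w2] := hw _ ih.
  by rewrite Normc.normcM normc_cexp mulr1 normc_real ger0_norm; lra.
have {}lower : n%:R * ((\sum_(i < h) i.+1%:R^-1) / 256 - 1) <= normc (G b0).
  apply: le_trans lower _; set S := \sum_(i < h) _.
  (* Since q_u^b0 = e((u + d) b0 / n), replacing x by x - b0/n in every phase costs only the factor
     e(- d b0 / n), independent of u. *)
  suff -> : S = cexp (- (d * b0%:R / n%:R)) * G b0.
    by rewrite Normc.normcM normc_cexp mul1r.
  rewrite /S /G mulr_sumr.
  apply: eq_bigr => i _; rewrite -cexpMn.
  set u : R := i.+1%:R; set c := _^-1.
  have -> : cexp (- (u * (x - b0%:R / n%:R))) =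
     cexp (- (d * b0%:R / n%:R)) * cexp (- (u * x)) * cexp (b0%:R * ((u + d) / n%:R)).
    by rewrite -!cexpD; congr cexp; field; lra.
  by ring.
have : n%:R * normc (G b0) <= n%:R * (n%:R * L) + n%:R ^+ 2.
  rewrite -[X in X * _ <= _](ger0_norm (ltW n0)) -normc_real -Normc.normcM.
  have -> : n%:R%:C * G b0 = \sum_(b < n) (G b0 - G b) + \sum_(b < n) G b.
    by rewrite big_split /= sumrN addrNK sumr_const card_ord rmorph_nat mulr_natl.
  apply: le_trans (le_normcD _ _) _; apply: lerD => //.
  apply: le_trans (ler_normc_sum _ _ _) _.
  apply: (@le_trans _ _ (\sum_(b < n) n%:R * L)).
    by apply: ler_sum => b _; exact: hG.
  by rewrite sumr_const card_ord -[leLHS]mulr_natl.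
move=> H; have : normc (G b0) <= n%:R * (L + 1).
  rewrite -(ler_pM2l n0); apply: le_trans H _.
  by rewrite le_eqVlt; apply/orP; left; apply/eqP; ring.
by move=> /(le_trans lower); rewrite ler_pM2l // => ?; lra.
Qed.

(** The phase k/2 replaces y by y + 1/2. For 0 <= y < 1 this keeps n(y + 1/2) between n/2 and 3n/2,
    where the triangular weights near that frequency are of order n. *)
Definition block_coef (n m k : nat) : R[i] :=
  ((tri n m)%:R / n%:R ^+ 2)%:C * cexp (k%:R / 2 - m%:R * (k%:R / n%:R)).

Lemma block_sumE (n : nat) (x y : R) :
  \sum_(m < n.*2) \sum_(k < n) block_coef n m k * cexp (m%:R * x + k%:R * y) =
  (n%:R ^- 2)%:C *
  \sum_(k < n) dirichlet n (x - k%:R / n%:R) ^+ 2 * cexp (k%:R * (y + 1 / 2)).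
Proof.
rewrite exchange_big mulr_sumr; apply: eq_bigr => k _.
rewrite dirichlet_sqr mulr_suml mulr_sumr; apply: eq_bigr => m _.
rewrite /block_coef [_ / _]mulrC rmorphM /= rmorph_nat -!mulrA -!cexpD.
congr (_ * (_ * _)); congr cexp; ring.
Qed.

Lemma block_sum_bounded (n : nat) (x y : R) : (0 < n)%N ->
  normc (\sum_(m < n.*2) \sum_(k < n)
    block_coef n m k * cexp (m%:R * x + k%:R * y)) <= 1.
Proof.
move=> n0; rewrite block_sumE Normc.normcM normc_real ger0_norm ?invr_ge0 ?exprn_ge0//.
rewrite -[leRHS](mulVf (x := n%:R ^+ 2)) ?expf_neq0 ?pnatr_eq0 -?lt0n //.
rewrite ler_wpM2l ?invr_ge0 ?exprn_ge0 // -(dirichlet_Parseval n x).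
apply: le_trans (ler_normc_sum _ _ _) _; apply: ler_sum => k _.
by rewrite Normc.normcM normc_cexp mulr1 !expr2 Normc.normcM.
Qed.

Lemma block_oscillation (n h : nat) (x y : R) : n = (64 * h)%N -> (0 < h)%N ->
  0 <= x < 1 -> 0 <= y < 1 ->
  exists a b0, [/\ (h <= a <= n.*2)%N, (b0 < n)%N &
   forall L, (forall b, (b < n)%N ->
     normc (\sum_(i < h) \sum_(k < b0) block_coef n (a - i.+1) k *
              cexp ((a - i.+1)%:R * x + k%:R * y) -
            \sum_(i < h) \sum_(k < b) block_coef n (a - i.+1) k *
              cexp ((a - i.+1)%:R * x + k%:R * y)) <= L) ->
   (\sum_(i < h) i.+1%:R^-1) / 256 - 2 <= L].
Proof.
move=> nE h0 /andP[x0 x1] /andP[y0 y1].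
have n0 : 0 < n%:R :> R by rewrite ltr0n; lia.
have nx0 : 0 <= n%:R * x by rewrite mulr_ge0 // ltW.
have ny0 : 0 <= n%:R * (y + 1 / 2) by rewrite mulr_ge0 ?ltW //; lra.
have /andP[xl xr] := truncn_itv nx0; have /andP[yl yr] := truncn_itv ny0.
set b0 := Num.truncn _ in xl xr; set a := Num.truncn _ in yl yr.
have nh : n%:R = 64 * h%:R :> R by rewrite nE natrM.
have h1 : 1 <= h%:R :> R by rewrite ler1n.
have an : (n <= 2 * a)%N.
  have : (n < 2 * a.+1)%N by rewrite -(ltr_nat R) natrM; nra.
  by clear -nE; lia.
have an' : (2 * a < 3 * n)%N.
  by rewrite -(ltr_nat R) !natrM; nra.
have ha : (h <= a)%N by clear -an nE; lia.
exists a, b0; split; [by clear -ha an'; lia| |move=> L hL].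
  by rewrite -(ltr_nat R); apply: le_lt_trans xl _; rewrite gtr_pMr.
(* [d] is the fractional part of n(y + 1/2). The frequencies a - i - 1 stay between n/4 and 3n/2
   because h = n/64, so [tri_ge] places the normalized weights [w] in [1/4, 1]. *)
pose d := n%:R * (y + 1 / 2) - a%:R.
pose w i := (tri n (a - i.+1))%:R / n%:R : R.
apply: (kernel_sum_oscillation h0 _ _ (d := d) (x := x) (b0 := b0) (n := n) (w := w)).
- by rewrite nE.
- by rewrite -(ltr_nat R); apply: le_lt_trans xl _; rewrite gtr_pMr.
- by move: yr; rewrite /d -[a.+1%:R]natr1 => ?; apply/andP; split; lra.
- apply/andP; split; first by rewrite subr_ge0 ler_pdivrMr // mulrC.
  rewrite -(ltr_pM2l n0) mulfV ?gt_eqF // mulrBr mulrCA mulfV ?gt_eqF // mulr1.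
  by move: xr; rewrite -[b0.+1%:R]natr1 => ?; lra.
- move=> i ih; rewrite /w ler_pdivlMr // ler_pdivrMr //.
  rewrite [1 * n%:R]mul1r ler_nat tri_le andbT.
  have : (n <= 4 * tri n (a - i.+1))%N by clear -an an' nE ih; apply: tri_ge; lia.
  by rewrite -(ler_nat R) natrM => ?; lra.
move=> b bn; apply: le_trans (ler_wpM2l (ltW n0) (hL b bn)).
rewrite -[X in _ <= X * _](ger0_norm (ltW n0)) -normc_real -Normc.normcM.
set q := fun i : nat => cexp ((i.+1%:R + d) / n%:R).
(* At frequency a - u, the phase in k is k(y + 1/2 - (a - u)/n) = k(u + d)/n, so the inner sum is
   geometric with ratio q_u. In the difference of two such sums the constant 1 cancels and only G(b)
   - G(b0) remains. *)
have E c : \sum_(i < h) \sum_(k < c) block_coef n (a - i.+1) k *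
              cexp ((a - i.+1)%:R * x + k%:R * y) =
  \sum_(i < h) (n%:R^-1)%:C * cexp (a%:R * x) *
    ((w i)%:C * cexp (- (i.+1%:R * x)) * ((1 - q i)^-1 * (1 - q i ^+ c))).
  apply: eq_bigr => i _.
  have id_lt : i.+1%:R + d < n%:R.
    have : i.+1%:R <= h%:R :> R by rewrite ler_nat ltn_ord.
    by move: yr; rewrite /d -[a.+1%:R]natr1 => ? ?; lra.
  have id_gt : 0 < i.+1%:R + d.
    by rewrite ltr_pwDl ?ltr0n // subr_ge0.
  have q1 : 1 - q i != 0.
    rewrite subr_eq0 eq_sym; apply: cexp_neq1.
    by rewrite divr_gt0 //= ltr_pdivrMr // mul1r.
  have <- : \sum_(k < c) q i ^+ k = (1 - q i)^-1 * (1 - q i ^+ c).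
    by apply: (mulfI q1); rewrite mulVKf // -opprB mulNr -subrX1 opprB.
  rewrite mulr_sumr mulr_sumr; apply: eq_bigr => k _.
  rewrite -cexpMn /block_coef /w.
  set T : R := (tri n (a - i.+1))%:R.
  have -> : T / n%:R ^+ 2 = n%:R^-1 * (T / n%:R) by field; rewrite gt_eqF.
  have key : cexp (k%:R / 2 - (a - i.+1)%:R * (k%:R / n%:R)) *
      cexp ((a - i.+1)%:R * x + k%:R * y) =
      cexp (a%:R * x) * cexp (- (i.+1%:R * x)) *
      cexp (k%:R * ((i.+1%:R + d) / n%:R)).
    rewrite -!cexpD; congr cexp; rewrite /d natrB; last first.
      exact: leq_trans (ltn_ord i) ha.
    by field; rewrite gt_eqF.
  by rewrite rmorphM -mulrA key; ring.
have nn : (n%:R : R)%:C * (n%:R^-1)%:C = 1 by rewrite -rmorphM mulfV ?gt_eqF.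
rewrite !E -!sumrB; set S := \sum_i _; set T := _%:C * _.
suff -> : T = cexp (a%:R * x) * - S.
  by rewrite Normc.normcM normc_cexp mul1r normcN.
rewrite /S /T -sumrN !mulr_sumr; apply: eq_bigr => i _; rewrite -mulrBr !mulrA nn.
by rewrite /q; ring.
Qed.

Lemma harmonic_sum_unbounded (A : R) :
  exists2 h, (0 < h)%N & A < \sum_(i < h) i.+1%:R^-1.
Proof.
have [h0|] := pselect (exists h, A < \sum_(i < h) (i.+1%:R : R)^-1).
  (* Passing to h + 1 secures positivity when the bound is already exceeded by the empty sum. *)
  have [h hA] := h0; exists h.+1 => //.
  by rewrite big_ord_recr /=; apply: lt_le_trans hA _; rewrite lerDl.
move=> /forallNP H; exfalso; apply: (@dvg_harmonic R).
apply: nondecreasing_is_cvgn.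
  by apply: nondecreasing_series => n _ _; rewrite /= /harmonic.
exists A => _ [n _ <-]; rewrite /series /= big_mkord leNgt; apply/negP.
exact: H.
Qed.

End fefferman_block.

(** * Integration of bounded complex functions over the torus *)

Section cintegral.
Context {R : realType}.
Local Notation mu := (lebesgue2 R).
Local Notation T2 := (torus2 R).
Implicit Types f g : R * R -> R[i].

Lemma measurable_torus2 : measurable T2.
Proof. by apply: measurableX; exact: measurable_itv. Qed.

Lemma lebesgue2_torus2 : mu T2 = 1%E.
Proof.
apply: etrans (product_measure1E _ _ _ _) _; [exact: measurable_itv..|].
have l : lebesgue_measure (`[0 : R, 1[ : set (measurableTypeR R)) = 1%E.
  by rewrite lebesgue_measure_itv /= lte_fin ltr01 oppr0 adde0.
by apply: etrans (congr2 mule l l) _; rewrite mul1e.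
Qed.

Lemma bounded_integrable_torus2 (g : measurableTypeR R * measurableTypeR R -> R) K :
  measurable_fun T2 g -> (forall p, `|g p| <= K) ->
  mu.-integrable T2 (EFin \o g).
Proof.
move=> mg gK; apply: measurable_bounded_integrable => //.
- exact: measurable_torus2.
- by rewrite [X in (X < _)%E](lebesgue2_torus2) ltry.
- exists K; split; first by rewrite num_real.
  by move=> y Ky p _ /=; exact: le_trans (gK p) (ltW Ky).
Qed.

(** The bound is required on the whole plane; trigonometric polynomials and their uniform limits
    satisfy it, and it gives integrability since the torus has measure 1. *)
Definition bounded_cmeasurable f :=
  cmeasurable f /\ exists K, forall p, normc (f p) <= K.

Lemma bounded_cmeasurable_integrable f : bounded_cmeasurable f ->
  mu.-integrable T2 (EFin \o (fun p => complex.Re (f p))) /\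
  mu.-integrable T2 (EFin \o (fun p => complex.Im (f p))).
Proof.
move=> [[mRe mIm] [K fK]]; split.
- apply: (@bounded_integrable_torus2 _ K) => // p.
  exact: le_trans (ler_normr_Re _) (fK p).
- apply: (@bounded_integrable_torus2 _ K) => // p.
  exact: le_trans (ler_normr_Im _) (fK p).
Qed.

Lemma ReD (z w : R[i]) : complex.Re (z + w) = complex.Re z + complex.Re w.
Proof. by case: z w => ? ? []. Qed.

Lemma ImD (z w : R[i]) : complex.Im (z + w) = complex.Im z + complex.Im w.
Proof. by case: z w => ? ? []. Qed.

Lemma ReM (z w : R[i]) :
  complex.Re (z * w) = complex.Re z * complex.Re w - complex.Im z * complex.Im w.
Proof. by case: z w => ? ? []. Qed.

Lemma ImM (z w : R[i]) :
  complex.Im (z * w) = complex.Re z * complex.Im w + complex.Im z * complex.Re w.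
Proof. by case: z w => ? ? []. Qed.

Lemma bounded_cmeasurable_cst (c : R[i]) : bounded_cmeasurable (fun=> c).
Proof. by split; [split; exact: measurable_cst | exists (normc c)]. Qed.

Lemma bounded_cmeasurableD f g : bounded_cmeasurable f -> bounded_cmeasurable g ->
  bounded_cmeasurable (fun p => f p + g p).
Proof.
move=> [[fr fi] [K fK]] [[gr gi] [L gL]]; split; last first.
  by exists (K + L) => p; exact: le_trans (le_normcD _ _) (lerD (fK p) (gL p)).
split; first by under eq_fun do rewrite ReD; exact: measurable_funD.
by under eq_fun do rewrite ImD; exact: measurable_funD.
Qed.

Lemma bounded_cmeasurableM f g : bounded_cmeasurable f -> bounded_cmeasurable g ->
  bounded_cmeasurable (fun p => f p * g p).
Proof.
move=> [[fr fi] [K fK]] [[gr gi] [L gL]]; split; last first.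
  exists (K * L) => p; rewrite Normc.normcM.
  by apply: ler_pM (fK p) (gL p); exact: normc_ge0.
split.
  by under eq_fun do rewrite ReM; apply: measurable_funB; exact: measurable_funM.
by under eq_fun do rewrite ImM; apply: measurable_funD; exact: measurable_funM.
Qed.

Lemma bounded_cmeasurable_sum (n : nat) (F : nat -> R * R -> R[i]) :
  (forall i, (i < n)%N -> bounded_cmeasurable (F i)) ->
  bounded_cmeasurable (fun p => \sum_(i < n) F i p).
Proof.
elim: n => [|n IH] hF.
  by under eq_fun do rewrite big_ord0; exact: bounded_cmeasurable_cst.
under eq_fun do rewrite big_ord_recr /=.
apply: bounded_cmeasurableD; last exact: hF.
by apply: IH => i ni; apply: hF; exact: ltnW.
Qed.

Lemma measurable_phase (a b c : R) (h : R -> R) : continuous h ->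
  measurable_fun [set: measurableTypeR R * measurableTypeR R]
    (fun p => h (a * p.1 + b * p.2 + c)).
Proof.
move=> ch; apply: (measurableT_comp (continuous_measurable_fun ch)).
apply: measurable_funD; last exact: measurable_cst.
apply: measurable_funD; apply: measurable_funM; try exact: measurable_cst.
- exact: measurable_fst.
- exact: measurable_snd.
Qed.

Lemma bounded_cmeasurable_cexp (a b : R) :
  bounded_cmeasurable (fun p => cexp (a * p.1 + b * p.2)).
Proof.
split; last by exists 1 => p; rewrite normc_cexp.
have e (p : R * R) : 2 * pi * (a * p.1 + b * p.2) =
   2 * pi * a * p.1 + 2 * pi * b * p.2 + 0 by ring.
split; apply: (@measurable_funS _ _ _ _ setT) => //=; under eq_fun do rewrite e.
- by apply: measurable_phase; exact: continuous_cos.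
- by apply: measurable_phase; exact: continuous_sin.
Qed.

Lemma cintegralD f g : bounded_cmeasurable f -> bounded_cmeasurable g ->
  cintegral (fun p => f p + g p) = cintegral f + cintegral g.
Proof.
move=> /bounded_cmeasurable_integrable[fr fi] /bounded_cmeasurable_integrable[gr gi].
rewrite /cintegral; under eq_Rintegral do rewrite ReD.
under [X in _ +i* X = _]eq_Rintegral do rewrite ImD.
by rewrite !RintegralD //; exact: measurable_torus2.
Qed.

Lemma cintegralZ (c : R[i]) f : bounded_cmeasurable f ->
  cintegral (fun p => c * f p) = c * cintegral f.
Proof.
move=> /bounded_cmeasurable_integrable[fr fi]; have mT := measurable_torus2.
have Z (k : R) (h : R * R -> R) : mu.-integrable T2 (EFin \o h) ->
    mu.-integrable T2 (EFin \o (fun p => k * h p)).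
  by move=> ih; have := integrableZl mT k ih.
rewrite /cintegral; under eq_Rintegral do rewrite ReM.
under [X in _ +i* X = _]eq_Rintegral do rewrite ImM.
rewrite RintegralB ?RintegralD ?RintegralZl //; try exact: Z.
by case: c.
Qed.

Lemma cintegral0 : cintegral (fun=> 0 : R[i]) = 0.
Proof.
by rewrite /cintegral /= /Rintegral integral0.
Qed.

Lemma cintegral_sum (n : nat) (F : nat -> R * R -> R[i]) :
  (forall i, (i < n)%N -> bounded_cmeasurable (F i)) ->
  cintegral (fun p => \sum_(i < n) F i p) = \sum_(i < n) cintegral (F i).
Proof.
elim: n => [|n IH] hF.
  by under eq_fun do rewrite big_ord0; rewrite big_ord0 cintegral0.
under eq_fun do rewrite big_ord_recr /=.
rewrite cintegralD ?big_ord_recr /= ?IH //.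
- by move=> i ni; apply: hF; exact: ltnW.
- by apply: bounded_cmeasurable_sum => i ni; apply: hF; exact: ltnW.
- exact: hF.
Qed.

(** Real and imaginary parts are estimated separately, whence the factor 2; the sharp constant 1 is
    immaterial for limits. *)
Lemma normc_cintegral_le f K : bounded_cmeasurable f ->
  (forall p, normc (f p) <= K) -> normc (cintegral f) <= 2 * K.
Proof.
move=> /bounded_cmeasurable_integrable[fr fi] fK; have mT := measurable_torus2.
have bd (h : R * R -> R) : mu.-integrable T2 (EFin \o h) ->
    (forall p, `|h p| <= K) -> `|Rintegral mu T2 h| <= K.
  move=> ih hK; apply: le_trans (le_normr_Rintegral mT ih) _.
  have -> : K = Rintegral mu T2 (cst K).
    by rewrite Rintegral_cst // [X in fine X]lebesgue2_torus2 mulr1.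
  apply: le_Rintegral => //.
    by have := integrable_norm ih.
  by apply: (@bounded_integrable_torus2 _ `|K|) => //; exact: measurable_cst.
apply: le_trans (ler_normc_ReIm _) _; rewrite mulr2n mulrDl !mul1r /=.
apply: lerD; apply: bd => // p.
- exact: le_trans (ler_normr_Re _) (fK p).
- exact: le_trans (ler_normr_Im _) (fK p).
Qed.

End cintegral.

(** * Orthogonality of characters and Fourier coefficients of uniform limits *)

Section fourier_series.
Context {R : realType}.
Local Notation mu := (lebesgue2 R).
Local Notation T2 := (torus2 R).

Lemma cexp_int (m : int) : cexp m%:~R = 1 :> R[i].
Proof.
case: m => n; first by rewrite -pmulrn cexp_nat.
by rewrite NegzE mulrNz cexpN -pmulrn cexp_nat rmorph1.
Qed.

Lemma sinD_int (m : int) (c : R) : sin (2 * pi * m%:~R + c) = sin c.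
Proof.
have := @cexpD R m%:~R (c / (2 * pi)); rewrite cexp_int mul1r /cexp => -[_].
have p0 := @pi_gt0 R.
by rewrite mulrDr (_ : 2 * pi * (c / _) = c) //; field; lra.
Qed.

(** The primitive sin(wx + c)/w, with w = 2 pi m, takes the same value at 0 and 1. *)
Lemma integral_cos_period (m : int) (c : R) : m != 0 ->
  (\int[lebesgue_measure]_(x in `[0%R, 1%R[) (cos (2 * pi * m%:~R * x + c))%:E = 0)%E.
Proof.
move=> m0; have p0 := @pi_gt0 R.
set w : R := 2 * pi * m%:~R.
have w0 : w != 0 by rewrite mulf_neq0 ?intr_eq0 // mulf_neq0 ?pnatr_eq0 ?gt_eqF.
have cw : continuous (fun x : R => cos (w * x + c)).
  move=> x; apply: continuous_comp; last exact: continuous_cos.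
  by apply: cvgD; [apply: cvgM; [exact: cvg_cst|exact: cvg_id]|exact: cvg_cst].
have dF (x : R) : is_derive x (1 : R)
    (fun x : R => w^-1 * sin (w * x + c)) (cos (w * x + c)).
  apply: is_derive_eq.
  by rewrite /GRing.scale /=; field.
have cF : continuous (fun x : R => w^-1 * sin (w * x + c)).
  move=> x; apply: differentiable_continuous; apply/derivable1_diffP.
  exact: ex_derive.
rewrite integral_itv_bndo_bndc; last first.
  apply/measurable_EFinP; apply: (@measurable_funS _ _ _ _ setT) => //.
  exact: continuous_measurable_fun.
rewrite (@continuous_FTC2 _ _ (fun x => w^-1 * sin (w * x + c))) ?ltr01 //.
- by rewrite mulr1 mulr0 add0r sinD_int subee.
- by apply: continuous_subspaceT.
- split.
  + by move=> x _; exact: (@ex_derive _ _ _ _ _ _ _ (dF x)).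
  + by apply: cvg_at_right_filter; exact: cF.
  + by apply: cvg_at_left_filter; exact: cF.
- by move=> x _; rewrite derive1E; exact: derive_val.
Qed.

(** The form met inside Fubini: [b] stands for the membership of the other variable in [0, 1[. *)
Lemma integral_cos_period_mkcond (m : int) (c : R) (b : bool) : m != 0 ->
  (\int[@lebesgue_measure R]_x
     (if b && (x \in `[0%R, 1%R[%classic)
      then (cos (2 * pi * m%:~R * x + c))%:E else 0%:E) = 0)%E.
Proof.
move=> m0; case: b => /=; last by rewrite integral0_eq.
by rewrite -[RHS](integral_cos_period c m0) [RHS]integral_mkcond.
Qed.

Lemma integrable_torus2_cos (a b c : R) :
  mu.-integrable T2 (EFin \o (fun p => cos (a * p.1 + b * p.2 + c))).
Proof.
apply: (@bounded_integrable_torus2 _ _ 1) => [|p]; last exact: cos_max.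
apply: (@measurable_funS _ _ _ _ setT) => //.
by apply: measurable_phase; exact: continuous_cos.
Qed.

(** By Fubini, integrate first in a variable whose frequency is nonzero. The free phase [c] lets the
    same statement serve for sines. *)
Lemma Rintegral_torus2_cos (m n : int) (c : R) : (m != 0) || (n != 0) ->
  Rintegral mu T2 (fun p => cos (2 * pi * m%:~R * p.1 + 2 * pi * n%:~R * p.2 + c)) = 0.
Proof.
move=> mn; rewrite /Rintegral integral_mkcond.
set g := patch _ _ _.
have gE x y : g (x, y) = if (x \in `[0 : R, 1[%classic) && (y \in `[0 : R, 1[%classic)
    then (cos (2 * pi * m%:~R * x + 2 * pi * n%:~R * y + c))%:E else 0%E.
  rewrite /g patchE /torus2.
  by rewrite in_setX.
have ig : mu.-integrable setT g.
  apply: (integrable_mkcond _ measurable_torus2).1.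
  exact: integrable_torus2_cos.
case/orP: mn => [m0|n0].
- rewrite -(integral21_prod_meas1 ig) integral0_eq // => y _.
  rewrite -[RHS](integral_cos_period_mkcond (2 * pi * n%:~R * y + c)
    (y \in `[0 : R, 1[%classic) m0).
  by apply: eq_integral => x _; rewrite gE addrA andbC.
- rewrite -(integral12_prod_meas1 ig) integral0_eq // => x _.
  rewrite -[RHS](integral_cos_period_mkcond (2 * pi * m%:~R * x + c)
    (x \in `[0 : R, 1[%classic) n0).
  by apply: eq_integral => y _; rewrite gE addrCA addrA.
Qed.

Lemma cintegral_cexp (a b : int) :
  cintegral (fun p => cexp (a%:~R * p.1 + b%:~R * p.2)) =
  ((a == 0) && (b == 0))%:R :> R[i].
Proof.
have [/andP[/eqP -> /eqP ->]|ab] := boolP ((a == 0) && (b == 0)).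
  under eq_fun do rewrite !mul0r addr0 cexp0.
  rewrite /cintegral !Rintegral_cst ?[in X in fine X]lebesgue2_torus2 //;
    try exact: measurable_torus2.
  by rewrite /= mulr1 mul0r.
rewrite negb_and in ab; rewrite /cintegral /cexp /=.
rewrite (_ : (fun p : R * R => cos _) =
  (fun p => cos (2 * pi * a%:~R * p.1 + 2 * pi * b%:~R * p.2 + 0))); last first.
  by apply/funext => p; congr cos; ring.
rewrite (_ : (fun p : R * R => sin _) =
  (fun p => cos (2 * pi * a%:~R * p.1 + 2 * pi * b%:~R * p.2 + - (pi / 2)))); last first.
  by apply/funext => p; rewrite cosBpihalf; congr sin; ring.
by rewrite !Rintegral_torus2_cos.
Qed.

Definition trig_poly (n : nat) (C : nat -> nat -> R[i]) (p : R * R) : R[i] :=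
  \sum_(m < n) \sum_(k < n) C m k * cexp (m%:R * p.1 + k%:R * p.2).

Lemma bounded_cmeasurable_trig_poly n C : bounded_cmeasurable (trig_poly n C).
Proof.
apply: (bounded_cmeasurable_sum (F := fun m p =>
  \sum_(k < n) C m k * cexp (m%:R * p.1 + k%:R * p.2))) => m _.
apply: (bounded_cmeasurable_sum (F := fun k p =>
  C m k * cexp (m%:R * p.1 + k%:R * p.2))) => k _.
by apply: bounded_cmeasurableM;
  [exact: bounded_cmeasurable_cst|exact: bounded_cmeasurable_cexp].
Qed.

Lemma bounded_cmeasurable_character (a b : int) :
  bounded_cmeasurable (fun p : R * R => cexp (- (a%:~R * p.1) - b%:~R * p.2)).
Proof.
rewrite (_ : (fun p => _) = fun p => cexp (- a%:~R * p.1 + - b%:~R * p.2)).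
  exact: bounded_cmeasurable_cexp.
by apply/funext => p; rewrite !mulNr.
Qed.

Lemma fourier_coef_trig_poly n C (a b : int) :
  fourier_coef (trig_poly n C) a b =
  \sum_(m < n) \sum_(k < n) C m k * ((m%:Z == a) && (k%:Z == b))%:R.
Proof.
rewrite /fourier_coef /trig_poly.
pose G (m k : nat) (p : R * R) :=
  C m k * cexp ((m%:Z - a)%:~R * p.1 + (k%:Z - b)%:~R * p.2).
have hG m k : bounded_cmeasurable (G m k).
  by apply: bounded_cmeasurableM;
  [exact: bounded_cmeasurable_cst|exact: bounded_cmeasurable_cexp].
rewrite (_ : (fun p => _) = fun p => \sum_(m < n) \sum_(k < n) G m k p); last first.
  apply/funext => p; rewrite mulr_suml; apply: eq_bigr => m _.
  rewrite mulr_suml; apply: eq_bigr => k _; rewrite /G -mulrA -cexpD.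
  by congr (_ * cexp _); rewrite !intrD !mulrNz; ring.
rewrite (cintegral_sum (F := fun m p => \sum_(k < n) G m k p)); last first.
  by move=> m _; exact: bounded_cmeasurable_sum.
apply: eq_bigr => m _; rewrite cintegral_sum //; apply: eq_bigr => k _.
by rewrite cintegralZ ?cintegral_cexp ?subr_eq0 //; exact: bounded_cmeasurable_cexp.
Qed.

Lemma fourier_coef_dist (f g : R * R -> R[i]) K (a b : int) :
  bounded_cmeasurable f -> bounded_cmeasurable g ->
  (forall p, normc (f p - g p) <= K) ->
  normc (fourier_coef f a b - fourier_coef g a b) <= 2 * K.
Proof.
move=> hf hg fgK; have he := bounded_cmeasurable_character a b.
pose e p := cexp (- (a%:~R * p.1) - b%:~R * p.2) : R[i].
have hN : bounded_cmeasurable (fun p => -1 * (g p * e p)).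
  apply: bounded_cmeasurableM; first exact: bounded_cmeasurable_cst.
  exact: bounded_cmeasurableM.
have hfe : bounded_cmeasurable (fun p => f p * e p) by exact: bounded_cmeasurableM.
rewrite /fourier_coef -[X in _ - X]mul1r -mulNr -cintegralZ;
  last exact: bounded_cmeasurableM.
rewrite -cintegralD //; apply: normc_cintegral_le; first exact: bounded_cmeasurableD.
by move=> p; rewrite mulN1r -mulrBl Normc.normcM normc_cexp mulr1.
Qed.

(** The tail of the series of 2^-i from J on is 2 * 2^-J, so u J - 2 * 2^-J increases, u J + 2 *
    2^-J decreases, and the supremum of the former lies between them. *)
Lemma geometric_limit (u : nat -> R) :
  (forall J, `|u J.+1 - u J| <= 2^-1 ^+ J) ->
  exists l, forall J, `|u J - l| <= 2 * 2^-1 ^+ J.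
Proof.
move=> hu; pose v J := u J - 2 * 2^-1 ^+ J; pose w J := u J + 2 * 2^-1 ^+ J.
have vS J : v J <= v J.+1.
  by have := hu J; rewrite ler_norml /v exprS => /andP[? ?]; lra.
have wS J : w J.+1 <= w J.
  by have := hu J; rewrite ler_norml /w exprS => /andP[? ?]; lra.
have vw J : v J <= w J.
  have : 0 <= 2^-1 ^+ J :> R by rewrite exprn_ge0.
  by rewrite /v /w => ?; lra.
have vm : {homo v : m n / (m <= n)%N >-> m <= n} by apply/nondecreasing_seqP.
have wm : {homo w : m n / (m <= n)%N >-> n <= m} by apply/nonincreasing_seqP.
have vwall K J : v K <= w J.
  have [KJ|/ltnW JK] := leqP K J; first exact: le_trans (vm _ _ KJ) (vw _).
  exact: le_trans (vw _) (wm _ _ JK).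
exists (sup (range v)) => J.
have l1 : v J <= sup (range v).
  apply: sup_upper_bound; last by exists J.
  by split; [exists (v 0), 0|exists (w 0) => _ [K _ <-]].
have l2 : sup (range v) <= w J.
  by apply: ge_sup; [exists (v 0), 0|move=> _ [K _ <-]].
by move: l1 l2; rewrite /v /w ler_norml => ? ?; apply/andP; split; lra.
Qed.

Lemma sum_symmetric_range (M : nat) (G : int -> R[i]) :
  (forall m : int, m < 0 -> G m = 0) ->
  \sum_(i < M.*2.+1) G (i%:Z - M%:Z) = \sum_(m < M.+1) G m%:Z.
Proof.
move=> G0; rewrite -(big_mkord xpredT (fun i => G (i%:Z - M%:Z))).
rewrite (@big_cat_nat _ _ _ M) //=; last by lia.
rewrite big_nat_cond big1 ?add0r; last first.
  by move=> i /andP[/andP[_ iM] _]; apply: G0; lia.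
rewrite -{1}[M]add0n big_addn (_ : (M.*2.+1 - M)%N = M.+1) ?big_mkord; last by lia.
by apply: eq_bigr => m _; congr G; lia.
Qed.

Lemma geometric_eq0 (x K : R) (J0 : nat) : 0 <= x ->
  (forall J, (J0 <= J)%N -> x <= K * 2^-1 ^+ J) -> x = 0.
Proof.
move=> x0 hx; apply/eqP; rewrite eq_le x0 andbT.
have c : (fun J => K * 2^-1 ^+ J) @ \oo --> K * 0.
  by apply: cvgM; [exact: cvg_cst|apply: cvg_expr; rewrite ger0_norm //; lra].
rewrite -[leRHS](mulr0 K) -(cvg_lim _ c) //; apply: limr_ge.
  by apply/cvg_ex; exists (K * 0).
by exists J0.
Qed.

(** The square sums at the stages [W J] converge uniformly to a bounded [f]. Its Fourier
    coefficients are the [C m k], so every rectangular sum of [f], not only those at the stages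
    [W J], is a rectangular sum of [C]. *)
Lemma ex_trig_series (C : nat -> nat -> R[i]) (W : nat -> nat) :
  (forall J, (W J < W J.+1)%N) ->
  (forall J p, normc (trig_poly (W J.+1) C p - trig_poly (W J) C p) <= 2^-1 ^+ J) ->
  exists f, L2_torus2 f /\ forall M L p, partial_sum f M L p =
    \sum_(m < M.+1) \sum_(k < L.+1) C m k * cexp (m%:R * p.1 + k%:R * p.2).
Proof.
move=> Wlt hF; pose F J := trig_poly (W J) C.
have WJ J : (J <= W J)%N by elim: J => // J IH; exact: leq_ltn_trans (Wlt J).
have hRe p : exists l, forall J, `|complex.Re (F J p) - l| <= 2 * 2^-1 ^+ J.
  apply: geometric_limit => J; apply: le_trans (hF J p); apply: le_trans (ler_normr_Re _).
  by rewrite -/(F J p) -/(F J.+1 p); case: (F J.+1 p) (F J p) => ? ? [].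
have hIm p : exists l, forall J, `|complex.Im (F J p) - l| <= 2 * 2^-1 ^+ J.
  apply: geometric_limit => J; apply: le_trans (hF J p); apply: le_trans (ler_normr_Im _).
  by rewrite -/(F J p) -/(F J.+1 p); case: (F J.+1 p) (F J p) => ? ? [].
have [fr hfr] := choice hRe; have [fi hfi] := choice hIm.
pose f p := fr p +i* fi p.
have fF J p : normc (F J p - f p) <= 4 * 2^-1 ^+ J.
  apply: le_trans (ler_normc_ReIm _) _.
  have := hfr p J; have := hfi p J; rewrite /f; case: (F J p) => a b /= ? ?; lra.
have cvg_bound (u : nat -> R) l :
    (forall J, `|u J - l| <= 2 * 2^-1 ^+ J) -> u @ \oo --> l.
  move=> hu; apply/cvgrPdist_lt => e e0.
  have c : (fun J => 2 * 2^-1 ^+ J : R) @ \oo --> 2 * (0 : R).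
    by apply: cvgM; [exact: cvg_cst|apply: cvg_expr; rewrite ger0_norm //; lra].
  rewrite mulr0 in c; have /cvgr_lt/(_ _ e0) := c.
  by apply: filterS => J; apply: le_lt_trans; rewrite distrC hu.
have bF J := bounded_cmeasurable_trig_poly (W J) C.
have bf : bounded_cmeasurable f.
  split; last first.
    have [K hK] := (bF 0).2; exists (K + 4) => p.
    rewrite -[f p](subrK (F 0 p)) addrC; apply: le_trans (le_normcD _ _) _.
    apply: lerD; [exact: hK|rewrite normc_distC; apply: le_trans (fF 0 p) _].
    by rewrite expr0 mulr1.
  split.
  - apply: (@measurable_fun_cvg _ _ _ _ (fun J p => complex.Re (F J p))).
      by move=> J; exact: (bF J).1.1.
    by move=> p _; apply: cvg_bound; exact: hfr.
  - apply: (@measurable_fun_cvg _ _ _ _ (fun J p => complex.Im (F J p))).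
      by move=> J; exact: (bF J).1.2.
    by move=> p _; apply: cvg_bound; exact: hfi.
(* From stage [J] on, the coefficient of [F K] at (a, b) no longer changes, and it differs from that
   of [f] by at most 2 * 4 * 2^-K; letting K grow gives equality. *)
have fcE (a b : int) J : (`|a| < W J)%N -> (`|b| < W J)%N ->
    fourier_coef f a b = if (0 <= a) && (0 <= b) then C `|a|%N `|b|%N else 0.
  move=> aJ bJ.
  have E K : (J <= K)%N -> fourier_coef (F K) a b =
      if (0 <= a) && (0 <= b) then C `|a|%N `|b|%N else 0.
    move=> JK; have WK : (W J <= W K)%N.
      by apply: (homo_leq (leqnn) leq_trans _ JK) => i; exact: ltnW.
    rewrite fourier_coef_trig_poly.
    case: a b aJ bJ => [a|a] [b|b] aJ bJ /=.
    - rewrite (bigD1 (Ordinal (leq_trans aJ WK))) //= [X in _ + X]big1 ?addr0; last first.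
        move=> i /negbTE ia; apply: big1 => k _.
        by rewrite eqz_nat -val_eqE /= in ia *; rewrite ia mulr0.
      rewrite (bigD1 (Ordinal (leq_trans bJ WK))) //= [X in _ + X]big1 ?addr0; last first.
        move=> k /negbTE kb.
        by rewrite !eqz_nat -val_eqE /= in kb *; rewrite kb andbF mulr0.
      by rewrite !eqxx mulr1.
    - by rewrite big1 // => i _; rewrite big1 // => k _; rewrite andbF mulr0.
    - by rewrite big1 // => i _; rewrite big1 // => k _; rewrite mulr0.
    - by rewrite big1 // => i _; rewrite big1 // => k _; rewrite mulr0.
  apply/eqP; rewrite -subr_eq0; apply/eqP; apply: Normc.eq0_normc.
  apply: (@geometric_eq0 _ 8 J); first exact: normc_ge0.
  move=> K JK; rewrite -(E K JK) normc_distC.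
  apply: le_trans (fourier_coef_dist _ _ (bF K) bf (fF K)) _; lra.
exists f; split.
  split; first exact: bf.1.
  have [K hK] := bf.2.
  have : mu.-integrable T2 (EFin \o (fun p => normc (f p) ^+ 2)).
    apply: (@bounded_integrable_torus2 _ _ (K ^+ 2)) => [|p].
      under eq_fun do rewrite normc_sqrE.
      by apply: measurable_funD; apply: measurable_funX; [exact: bf.1.1|exact: bf.1.2].
    rewrite normrX [`|_|]ger0_norm ?normc_ge0 // !expr2.
    by apply: ler_pM => //; exact: normc_ge0.
  move=> /integrableP[_]; congr (_ < _)%E; apply: eq_integral => p _ /=.
  by rewrite ger0_norm // exprn_ge0 // normc_ge0.
move=> M L p; rewrite /partial_sum.
have {}fcE (a b : int) : fourier_coef f a b =
    if (0 <= a) && (0 <= b) then C `|a|%N `|b|%N else 0.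
  apply: (fcE _ _ (maxn `|a| `|b|).+1); apply: leq_trans (WJ _).
    by rewrite ltnS leq_maxl.
  by rewrite ltnS leq_maxr.
pose H (m n : int) := fourier_coef f m n * cexp (m%:~R * p.1 + n%:~R * p.2).
rewrite (@sum_symmetric_range M (fun m =>
  \sum_(j < L.*2.+1) H m (j%:Z - L%:Z))); last first.
  move=> m m0; apply: big1 => j _.
  by rewrite /H fcE leNgt m0 mul0r.
apply: eq_bigr => m _; rewrite (@sum_symmetric_range L (H m)).
  by apply: eq_bigr => k _; rewrite /H fcE -!pmulrn.
by move=> n n0; rewrite /H fcE [0 <= n]leNgt n0 andbF mul0r.
Qed.

End fourier_series.

(** * Full squares contained in [Omega lambda] *)

(** Take n with n lambda_n > 2w. By monotonicity M lambda_M >= w for n/2 <= M <= n, and then |M - L|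
    <= w implies both ratio conditions, which read L <= M + M lambda_M and M <= L + L lambda_L. *)
Lemma Omega_window (R : realType) (lambda : nat -> R)
    (lambda_gt0 : forall n : nat, (1 <= n)%N -> 0 < lambda n)
    (lambda_noninc : forall m n : nat, (1 <= m)%N -> (m <= n)%N ->
       lambda n <= lambda m)
    (sup_lambda : ereal_sup [set (n%:R * lambda n)%:E |
       n in [set n : nat | (1 <= n)%N]] = +oo%E) (w K : nat) :
  exists N, (K <= N)%N /\
    forall M L, (N <= M.+1 <= N + w)%N -> (N <= L.+1 <= N + w)%N ->
      Omega lambda (M, L).
Proof.
have l1 := lambda_gt0 1%N isT.
(* The second entry forces n >= 2w + K + 2, since smaller n have n lambda_n <= (2w + K + 2)
   lambda_1. Hence n - w is at least both n/2 and K. *)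
pose A := Num.max (2 * w%:R) ((2 * w + K + 2)%:R * lambda 1%N).
have [_ [n n1 <-]] : exists2 y, [set (n%:R * lambda n)%:E |
    n in [set n : nat | (1 <= n)%N]] y & (A%:E < y)%E.
  by apply: ereal_sup_gt; rewrite sup_lambda ltry.
rewrite lte_fin /A gt_max => /andP[A1 A2].
have nK : (2 * w + K + 2 <= n)%N.
  rewrite leqNgt; apply/negP => nK.
  have : n%:R * lambda n <= (2 * w + K + 2)%:R * lambda 1%N.
    apply: ler_pM => //;
      [exact/ltW/lambda_gt0|by rewrite ler_nat ltnW|exact: lambda_noninc].
  by rewrite leNgt A2.
have win M : (n - w <= M <= n)%N -> w%:R <= M%:R * lambda M.
  move=> /andP[M1 M2]; have M0 : (1 <= M)%N by clear -M1 nK; lia.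
  have : n%:R / 2 * lambda n <= M%:R * lambda M.
    apply: ler_pM; [by rewrite divr_ge0|exact/ltW/lambda_gt0| |exact: lambda_noninc].
    rewrite ler_pdivrMr // -natrM ler_nat; clear -M1 nK; lia.
  by move=> ?; lra.
(* The window is stated for M + 1 and L + 1, the numbers of nonnegative frequencies in the partial
   sum; M and L themselves range over [n - w, n]. *)
exists (n - w).+1; split=> [|M L hM hL]; first by clear -nK; lia.
have {}hM : (n - w <= M <= n)%N by clear -hM nK; lia.
have {}hL : (n - w <= L <= n)%N by clear -hL nK; lia.
have M0 : (1 <= M)%N by clear -hM nK; lia.
have L0 : (1 <= L)%N by clear -hL nK; lia.
have lM := lambda_gt0 _ M0; have lL := lambda_gt0 _ L0.
have LM : L%:R <= M%:R + w%:R :> R by rewrite -natrD ler_nat; clear -hM hL nK; lia.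
have ML : M%:R <= L%:R + w%:R :> R by rewrite -natrD ler_nat; clear -hM hL nK; lia.
have M0R : 0 < M%:R :> R by rewrite ltr0n.
have L0R : 0 < L%:R :> R by rewrite ltr0n.
have wM := win M hM; have wL := win L hL.
split => //=.
  by rewrite ler_pdivlMr // mulrC ler_pdivrMr; [lra|lra].
by rewrite ler_pdivrMr //; lra.
Qed.

Lemma big_ord_support (V : nmodType) (n N l : nat) (F : nat -> V) :
  (N + l <= n)%N -> (forall i, (i < n)%N -> ~~ (N <= i < N + l)%N -> F i = 0) ->
  \sum_(i < n) F i = \sum_(i < l) F (N + i)%N.
Proof.
move=> Nln F0; rewrite -(big_mkord xpredT F) (@big_cat_nat _ _ _ N) //=; last by lia.
rewrite (@big_cat_nat _ _ _ (N + l) N n) //=; last by lia.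
rewrite big_nat_cond big1 ?add0r; last first.
  by move=> i /andP[/andP[i1 i2] _]; apply: F0; lia.
rewrite [X in _ + X]big_nat_cond [X in _ + X]big1 ?addr0; last first.
  by move=> i /andP[/andP[i1 i2] _]; apply: F0; lia.
rewrite -{1}[N]add0n big_addn addKn big_mkord.
by apply: eq_bigr => i _; rewrite addnC.
Qed.

(** * Superposition of translated blocks with disjoint frequency ranges *)

Section lacunary_blocks.
Context {R : realType}.
(* Block [j] has size [64 * h j] and lowest frequency [N j]; blocks [0..j-1]
   live below [W j]. *)
Variables (h N : nat -> nat).

Definition block_size (j : nat) : nat := (64 * h j)%N.

Definition lacunary_coef (j m k : nat) : R[i] :=
  if (N j <= m < N j + (block_size j).*2)%N && (N j <= k < N j + block_size j)%N
  then (2^-1 ^+ j)%:C * block_coef (block_size j) (m - N j) (k - N j) else 0.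

(** A finite form of the sum over all blocks: under the hypotheses below, block j starts at a
    frequency at least j, so blocks beyond [m] contribute nothing at [m]. *)
Definition total_coef (m k : nat) : R[i] := \sum_(j < m.+1) lacunary_coef j m k.

Variable W : nat -> nat.
Hypothesis h0 : forall j, (0 < h j)%N.
Hypothesis WS : forall j, W j.+1 = (N j + (block_size j).*2)%N.
Hypothesis WN : forall j, (W j <= N j)%N.

Lemma block_end_lt j : (W j < W j.+1)%N.
Proof. by rewrite WS /block_size; have := WN j; have := h0 j; lia. Qed.

Lemma block_end_mono i j : (i <= j)%N -> (W i <= W j)%N.
Proof.
by move=> ij; apply: (homo_leq leqnn leq_trans _ ij) => k; exact/ltnW/block_end_lt.
Qed.

Lemma block_end_ge j : (j <= W j)%N.
Proof. by elim: j => // j IH; exact: leq_ltn_trans (block_end_lt j). Qed.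

Lemma total_coefE J m k : (m < W J)%N ->
  total_coef m k = \sum_(j < J) lacunary_coef j m k.
Proof.
move=> mJ; have tail i : (J <= i)%N -> lacunary_coef i m k = 0.
  move=> Ji; rewrite /lacunary_coef ifF //; apply/negbTE.
  by have := block_end_mono Ji; have := WN i; lia.
have tail' i : (m < i)%N -> lacunary_coef i m k = 0.
  move=> mi; rewrite /lacunary_coef ifF //; apply/negbTE.
  by have := block_end_ge i; have := WN i; lia.
rewrite /total_coef.
(* Both truncations are compared with a common longer sum, whose extra terms vanish. *)
rewrite -(@big_ord_support _ (m.+1 + J) 0 m.+1 (fun j => lacunary_coef j m k)).
- apply: (@big_ord_support _ _ 0 J (fun j => lacunary_coef j m k)); first by lia.
  by move=> i _ iJ; apply: tail; lia.
- by lia.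
- by move=> i _ im; apply: tail'; lia.
Qed.

Lemma total_coef_block j m k : (N j <= m < N j + (block_size j).*2)%N ->
  total_coef m k = lacunary_coef j m k.
Proof.
move=> hm; rewrite (@total_coefE j.+1) ?WS; last by case/andP: hm.
rewrite big_ord_recr /= big1 ?add0r // => i _.
rewrite /lacunary_coef ifF //; apply/negbTE.
by have := block_end_mono (ltn_ord i); rewrite WS; have := WN j; lia.
Qed.

(** Translating the frequencies by (N j, N j) multiplies the block by a character, which leaves its
    modulus unchanged. *)
Lemma lacunary_blockE j n p : (W j.+1 <= n)%N ->
  \sum_(m < n) \sum_(k < n) lacunary_coef j m k * cexp (m%:R * p.1 + k%:R * p.2) =
  (2^-1 ^+ j)%:C * cexp ((N j)%:R * p.1 + (N j)%:R * p.2) *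
  \sum_(m < (block_size j).*2) \sum_(k < block_size j)
    block_coef (block_size j) m k * cexp (m%:R * p.1 + k%:R * p.2).
Proof.
rewrite WS => hn.
rewrite (@big_ord_support _ n (N j) (block_size j).*2
  (fun m => \sum_(k < n) lacunary_coef j m k *
    cexp (m%:R * p.1 + k%:R * p.2))) //; last first.
  move=> i _ /negbTE hi; apply: big1 => k _.
  by rewrite /lacunary_coef hi mul0r.
rewrite mulr_sumr; apply: eq_bigr => m _.
rewrite (@big_ord_support _ n (N j) (block_size j)
  (fun k => lacunary_coef j (N j + m) k *
    cexp ((N j + m)%:R * p.1 + k%:R * p.2))); last 2 first.
- by rewrite -addnn in hn; lia.
- by move=> k _ /negbTE hk; rewrite /lacunary_coef hk andbF mul0r.
rewrite mulr_sumr; apply: eq_bigr => k _.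
rewrite /lacunary_coef !leq_addr !ltn_add2l !ltn_ord /= !addKn.
move: (block_coef _ _ _) => B; rewrite -!mulrA [in RHS](mulrCA _ B) -cexpD.
by congr (_ * (_ * _)); congr cexp; rewrite !natrD; ring.
Qed.

Lemma trig_poly_block_end J p : trig_poly (W J) total_coef p =
  \sum_(j < J) (2^-1 ^+ j)%:C * cexp ((N j)%:R * p.1 + (N j)%:R * p.2) *
  \sum_(m < (block_size j).*2) \sum_(k < block_size j)
    block_coef (block_size j) m k * cexp (m%:R * p.1 + k%:R * p.2).
Proof.
under [RHS]eq_bigr => j _ do rewrite -(lacunary_blockE p (block_end_mono (ltn_ord j))).
rewrite exchange_big /=; apply: eq_bigr => m _.
rewrite exchange_big /=; apply: eq_bigr => k _.
by rewrite (total_coefE k (ltn_ord m)) mulr_suml.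
Qed.

Lemma trig_poly_block_end_dist J p :
  normc (trig_poly (W J.+1) total_coef p - trig_poly (W J) total_coef p) <=
  2^-1 ^+ J.
Proof.
rewrite !trig_poly_block_end big_ord_recr /= addrAC subrr add0r.
rewrite !Normc.normcM normc_cexp mulr1 normc_real ger0_norm ?exprn_ge0 ?invr_ge0 //.
rewrite ler_piMr ?exprn_ge0 ?invr_ge0 // block_sum_bounded //.
by rewrite /block_size; have := h0 J; lia.
Qed.

(** Subtracting leaves a strip of [h j] consecutive values of the first frequency, all in the range
    of block [j]; the lower blocks cancel. *)
Lemma rectangle_in_block j p a b :
  (h j <= a <= (block_size j).*2)%N -> (b <= block_size j)%N ->
  (\sum_(m < N j + a) \sum_(k < N j + b)
     total_coef m k * cexp (m%:R * p.1 + k%:R * p.2)) -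
  (\sum_(m < N j + a - h j) \sum_(k < N j + b)
     total_coef m k * cexp (m%:R * p.1 + k%:R * p.2)) =
  (2^-1 ^+ j)%:C * cexp ((N j)%:R * p.1 + (N j)%:R * p.2) *
  \sum_(i < h j) \sum_(k < b) block_coef (block_size j) (a - i.+1) k *
     cexp ((a - i.+1)%:R * p.1 + k%:R * p.2).
Proof.
move=> /andP[ha a2] bn.
pose F m := \sum_(k < N j + b) total_coef m k * cexp (m%:R * p.1 + k%:R * p.2).
rewrite -(big_mkord xpredT F) (@big_cat_nat _ _ _ (N j + a - h j)) //=; last by lia.
rewrite big_mkord addrAC subrr add0r -{1}[(N j + a - h j)%N]add0n big_addn.
rewrite (_ : (N j + a - _)%N = h j) ?big_mkord; last by lia.
(* The strip is counted downwards from its top, so that index i corresponds to u = i + 1 in the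
   kernel sums. *)
rewrite (reindex_inj rev_ord_inj) /= mulr_sumr; apply: eq_bigr => i _.
have -> : (h j - i.+1 + (N j + a - h j) = N j + (a - i.+1))%N.
  by have := ltn_ord i; lia.
have ai : (a - i.+1 < (block_size j).*2)%N by have := ltn_ord i; have := h0 j; lia.
have -> : F (N j + (a - i.+1))%N = \sum_(k < N j + b)
    lacunary_coef j (N j + (a - i.+1)) k *
    cexp ((N j + (a - i.+1))%:R * p.1 + k%:R * p.2).
  apply: eq_bigr => k _.
  by rewrite (@total_coef_block j) // leq_addr ltn_add2l.
rewrite (@big_ord_support _ _ (N j) b (fun k => lacunary_coef j (N j + (a - i.+1)) k *
  cexp ((N j + (a - i.+1))%:R * p.1 + k%:R * p.2))) //; last first.
  move=> k kb hk; rewrite /lacunary_coef ifF ?mul0r //.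
  by apply/negbTE; rewrite negb_and; apply/orP; right; lia.
rewrite mulr_sumr; apply: eq_bigr => k _.
rewrite /lacunary_coef !leq_addr !ltn_add2l ai (leq_trans (ltn_ord k) bn) /= !addKn.
move: (block_coef _ _ _) => B; rewrite -!mulrA [in RHS](mulrCA _ B) -cexpD.
by congr (_ * (_ * _)); congr cexp; rewrite !natrD; ring.
Qed.

End lacunary_blocks.

(** * Choice of the parameters and divergence at every point *)

Theorem theorem1p1 (R : realType) (lambda : nat -> R)
    (lambda_gt0 : forall n : nat, (1 <= n)%N -> 0 < lambda n)
    (lambda_noninc : forall m n : nat, (1 <= m)%N -> (m <= n)%N ->
       lambda n <= lambda m)
    (sup_lambda : ereal_sup [set (n%:R * lambda n)%:E |
       n in [set n : nat | (1 <= n)%N]] = +oo%E) :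
  exists f : R * R -> R[i],
    L2_torus2 f /\
    {ae lebesgue2 R, forall p, torus2 R p ->
       ~ Omega_limit_exists lambda (fun M L => partial_sum f M L p)}.
Proof.
(* The constants 256 and 2 are those of [block_oscillation]; 4 bounds the oscillation that a limit
   would permit, and 2^j undoes the coefficient of block j. *)
have [h hP] := choice (fun j => let: ex_intro2 n n0 hn :=
  @harmonic_sum_unbounded R (256 * (4 * 2 ^+ j + 2)) in ex_intro _ n (conj n0 hn)).
have h0 j : (0 < h j)%N := (hP j).1.
pose w (j : nat) := (block_size h j).*2.
have [Nf NfP] := choice (fun jK : nat * nat =>
  Omega_window lambda_gt0 lambda_noninc sup_lambda (w jK.1) jK.2).
(* Block i is placed in a window found beyond [W i], and [W] then moves to the end of that
   window. *)
pose fix W (j : nat) : nat :=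
  if j is i.+1 then (Nf (i, W i) + w i)%N else 0%N.
pose N j := Nf (j, W j).
have WS j : W j.+1 = (N j + (block_size h j).*2)%N by [].
have WN j : (W j <= N j)%N by have [] := NfP (j, W j).
have win j M L : (N j <= M.+1 <= N j + w j)%N ->
    (N j <= L.+1 <= N j + w j)%N -> Omega lambda (M, L).
  exact: (NfP (j, W j)).2.
have [f [f2 fS]] := @ex_trig_series R (total_coef h N) W
  (block_end_lt h0 WS WN) (@trig_poly_block_end_dist R h N W h0 WS WN).
(* Divergence is shown at every point of the torus, hence almost everywhere. *)
exists f; split => //; apply: aeW => -[x y] [/= x01 y01] [s lim_s].
have [K hK] := lim_s 1 ltr01.
(* With this choice N J >= W J >= J > K, so all partial sums in the window of block J lie within 1
   of [s]. *)
pose J := K.+1; have hJ := h0 J; set n := block_size h J.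
have [a [b0 [aP b0n osc]]] := @block_oscillation R n (h J) x y erefl hJ x01 y01.
have KN : (K < N J)%N by exact: leq_trans (block_end_ge h0 WS WN J) (WN J).
pose T m k : R[i] := \sum_(i < m) \sum_(j < k)
  total_coef h N i j * cexp (i%:R * x + j%:R * y).
(* [T m k] is the partial sum of indices m - 1 and k - 1; both m and k are positive since N J >
   K. *)
have near_s m k : (N J <= m <= N J + n.*2)%N -> (N J <= k <= N J + n.*2)%N ->
    normc (T m k - s) < 1.
  case: m k => [|m] [|k] hm hk; [by clear -hm hk KN; lia..|].
  rewrite /T -(fS m k (x, y)); apply: hK; first exact: (win J).
  by rewrite leq_min; apply/andP; split; clear -hm hk KN; lia.
(* [D b] isolates the strip of block J below a. A difference D b - D b' involves four partial sums,
   each within 1 of [s], hence the bound 4. *)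
pose D b := T (N J + a)%N (N J + b)%N - T (N J + a - h J)%N (N J + b)%N.
have D_le b b' : (b < n)%N -> (b' < n)%N -> normc (D b - D b') <= 4.
  move=> bn bn'.
  have -> : D b - D b' =
    (T (N J + a)%N (N J + b)%N - s) - (T (N J + a - h J)%N (N J + b)%N - s)
    - ((T (N J + a)%N (N J + b')%N - s) - (T (N J + a - h J)%N (N J + b')%N - s)).
    by rewrite /D; ring.
  have tri2 (z1 z2 : R[i]) (e1 e2 : R) : normc z1 <= e1 -> normc z2 <= e2 ->
      normc (z1 - z2) <= e1 + e2.
    by move=> h1 h2; apply: le_trans (le_normcD _ _) _; rewrite normcN lerD.
  have -> : 4 = (1 + 1) + (1 + 1) :> R by ring.
  by apply: (tri2); apply: (tri2); apply/ltW/near_s; clear -aP bn bn' hJ; lia.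
have DE b : (b < n)%N -> D b = (2^-1 ^+ J)%:C * cexp ((N J)%:R * x + (N J)%:R * y) *
  \sum_(i < h J) \sum_(k < b) block_coef n (a - i.+1) k *
     cexp ((a - i.+1)%:R * x + k%:R * y).
  by move=> bn; apply: (@rectangle_in_block R h N W h0 WS WN J (x, y) a b aP (ltnW bn)).
have harm := (hP J).2; suff : (\sum_(i < h J) i.+1%:R^-1) / 256 - 2 <= 4 * 2 ^+ J :> R.
  by clear -harm => ?; lra.
(* Dividing by the coefficient 2^-J turns the bound 4 into 4 * 2^J, which the choice of [h J]
   contradicts. *)
apply: osc => b bn; have := D_le _ _ b0n bn.
rewrite !DE // -mulrBr !Normc.normcM normc_cexp mulr1 normc_real.
rewrite ger0_norm ?exprn_ge0 ?invr_ge0 //.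
by rewrite exprVn mulrC ler_pdivrMr ?exprn_gt0.
Qed.
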